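(* Let $A$ be an abelian group and $c\in A$. The Galkin quandle $G(A,c)$ is medial if and only if $3A=0$.
   Context: $\mathbb{Z}_n$ denotes the integers modulo $n$. A quandle is a non-empty set $X$ with a binary operation $*$ such that: (1) $a*a=a$ for all $a\in X$; (2) for all $b,c\in X$ there is a unique $a\in X$ with $a*b=c$; (3) $(a*b)*c=(a*c)*(b*c)$ for all $a,b,c\in X$. For an abelian group $A$ and $c\in A$, the Galkin quandle $G(A,c)$ is the set $\mathbb{Z}_3\times A$ with operation $(x,a)*(y,b)=(2y-x,\,-a+\mu(x-y)b+\tau(x-y))$, where $\mu:\mathbb{Z}_3\to\mathbb{Z}$ is given by $\mu(0)=2$, $\mu(1)=\mu(2)=-1$, and $\tau:\mathbb{Z}_3\to A$ is given by $\tau(0)=\tau(1)=0$, $\tau(2)=c$. A quandle $X$ is medial if $(a*b)*(c*d)=(a*c)*(b*d)$ for all $a,b,c,d\in X$. $3A=0$ means $3a=0$ for all $a\in A$. *)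

(* Defs.v *)
From mathcomp Require Import all_boot all_order all_algebra.

Set Implicit Arguments.
Unset Strict Implicit.
Unset Printing Implicit Defensive.

Import GRing.Theory.
Local Open Scope ring_scope.

Declare Scope quandle_scope.
Delimit Scope quandle_scope with quandle.

Record quandle := Quandle {
  qcarrier :> Type;
  qop : qcarrier -> qcarrier -> qcarrier;
  q_nonempty : inhabited qcarrier;
  q_idem : forall a, qop a a = a;
  q_rdiv : forall b c, exists! a, qop a b = c;
  q_distr : forall a b c, qop (qop a b) c = qop (qop a c) (qop b c)
}.

Notation "a * b" := (qop a b) : quandle_scope.

Definition medial (X : quandle) : Prop :=
  forall a b c d : X, ((a * b) * (c * d) = (a * c) * (b * d))%quandle.

Definition galkin_mu (x : 'Z_3) : int := if x == 0 then 2 else -1.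

Definition galkin_tau (A : zmodType) (c : A) (x : 'Z_3) : A :=
  if x == 2 then c else 0.

Definition galkin_op (A : zmodType) (c : A) (p q : 'Z_3 * A) : 'Z_3 * A :=
  let: (x, a) := p in
  let: (y, b) := q in
  (2 * y - x, - a + b *~ galkin_mu (x - y) + galkin_tau c (x - y)).

Lemma galkin_idem (A : zmodType) (c : A) p : galkin_op c p p = p.
Proof.
case: p => x a; rewrite /galkin_op subrr /galkin_mu /galkin_tau /= addr0.
by rewrite mulr_natl mulr2n addrK -pmulrn mulr2n addKr.
Qed.

Lemma galkin_rdiv (A : zmodType) (c : A) q r :
  exists! p, galkin_op c p q = r.
Proof.
case: q r => [y b] [z d].
pose x := 2 * y - z.
exists (x, b *~ galkin_mu (x - y) + galkin_tau c (x - y) - d).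
split=> [|[x' a']]; rewrite /galkin_op.
  congr (_, _); first by rewrite /x subKr.
  by rewrite opprB -addrA; exact: addrNK.
case=> xE <-; have -> : x' = x by rewrite /x -xE subKr.
by congr (_, _); rewrite -(addrA (- a')) opprD opprK addrCA subrr addr0.
Qed.

Lemma galkin_distr (A : zmodType) (c : A) p q r :
  galkin_op c (galkin_op c p q) r =
  galkin_op c (galkin_op c p r) (galkin_op c q r).
Proof.
pose t (x : 'Z_3) : int := (x == 2)%:R.
have tauE x : galkin_tau c x = c *~ t x.
  by rewrite /galkin_tau /t; case: eqP.
case: p q r => [x a] [y b] [z d]; rewrite /galkin_op !tauE.
have [e1 e2 e3 e4] :
  [/\ 2 * z - (2 * y - x) = 2 * (2 * z - y) - (2 * z - x),
      - galkin_mu (x - y) = - galkin_mu (2 * z - x - (2 * z - y)),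
      galkin_mu (2 * y - x - z) = - galkin_mu (x - z)
        + galkin_mu (y - z) * galkin_mu (2 * z - x - (2 * z - y))
    & - t (x - y) + t (2 * y - x - z) = - t (x - z)
        + t (y - z) * galkin_mu (2 * z - x - (2 * z - y))
        + t (2 * z - x - (2 * z - y))].
  case: x y z => [[|[|[|x]]] ?] [[|[|[|y]]] ?] [[|[|[|z]]] ?] //;
    by split; apply/eqP.
congr (_, _); first exact: e1.
move: e2 e3 e4; set w := 2 * z - x - (2 * z - y); set m := galkin_mu w.
move=> e2 e3 e4; have := congr1 (fun n => c *~ n) e4; rewrite /= !mulrzDr => e5.
rewrite e3 !mulrzDl !mulNrz !opprD !opprK -!mulrzA -!mulrNz e2 mulrzDr.
rewrite [LHS](AC (3*2*1) ((1*2*4*5)*(3*6))) /= e5.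
by rewrite [LHS](AC (4*3) ((1*3*5)*(2*4*6)*7)).
Qed.

Definition galkin (A : zmodType) (c : A) : quandle :=
  @Quandle ('Z_3 * A)%type (galkin_op c) (inhabits (0, 0))
    (galkin_idem c) (galkin_rdiv c) (galkin_distr c).

(* Main.v *)
Require Import Defs.
From mathcomp Require Import all_boot all_order all_algebra.
From mathcomp Require Import ring.

(** Expanding [(p * q) * (r * s)] for [p = (x, a)], [q = (y, b)], [r = (z, d)],
    [s = (w, e)] shows what mediality asks for: the expression must be
    unchanged when [q] and [r] are exchanged.

    If [3A = 0], then [2 = -1] as scalars on [A], so [mu] may be replaced by the
    constant [-1]; and multiples of [c] depend only on residues modulo 3, so
    [tau] may be replaced by [c] times a polynomial function on [Z_3], namely
    [u - u ^ 2], which takes the values [0, 0, 1].  The operation becomes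
    [(x, a) * (y, b) = (2y - x, - (a + b) + c (u - u ^ 2))] with [u = x - y]
    ([galkin_op_char3]).  The [A]-part of [(p * q) * (r * s)] is then
    [a + b + d + e] plus [c] times a polynomial in [x, y, z, w] over [Z_3],
    and this polynomial is symmetric in [y] and [z] because [3 = 0] in [Z_3].

    Conversely, [b] contributes [- mu (x - y) b] to one side and
    [- mu (y + w - x - z) b] to the other.  Taking [x = y] and [z <> w] makes
    these coefficients [-2] and [1], so mediality forces [3b = 0]. *)

Import GRing.Theory.
Local Open Scope ring_scope.

Lemma Z3_mulrn3 (u : 'Z_3) : u *+ 3 = 0.
Proof. by case: u => [[|[|[|u]]] ?] //; apply/eqP. Qed.

(** The multiples of a 3-torsion element are indexed additively by ['Z_3],
    since representatives of the same residue give the same multiple. *)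
Lemma mulrn_Z3_additive {A : zmodType} {c : A} : c *+ 3 = 0 ->
  {morph (fun u : 'Z_3 => c *+ u) : u v / u - v}.
Proof.
move=> c3 u v.
have fD (s t : 'Z_3) : c *+ (s + t)%R = c *+ s + c *+ t.
  rewrite -mulrnDr (divn_eq (s + t)%N 3) [RHS]mulrnDr mulnC [in RHS]mulrnA c3.
  by rewrite mul0rn add0r.
by apply/(addIr (c *+ v)); rewrite -fD !subrK.
Qed.

Lemma galkin_muE3 (A : zmodType) (b : A) (u : 'Z_3) :
  b *+ 3 = 0 -> b *~ galkin_mu u = - b.
Proof.
move=> b3; rewrite /galkin_mu; case: eqP => _; last by rewrite mulrN1z.
by apply/eqP; rewrite -addr_eq0 -pmulrn -mulrSr b3.
Qed.

(** [u - u ^ 2] interpolates [0, 0, 1] at the three points of ['Z_3]. *)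
Lemma galkin_tauE (A : zmodType) (c : A) (u : 'Z_3) :
  galkin_tau c u = c *+ (u - u ^+ 2)%R.
Proof. by case: u => [[|[|[|u]]] ?]. Qed.

Lemma galkin_op_char3 (A : zmodType) (c : A) (x y : 'Z_3) (a b : A) :
  b *+ 3 = 0 ->
  galkin_op c (x, a) (y, b) =
  (2 * y - x, - (a + b) + c *+ ((x - y) - (x - y) ^+ 2)%R).
Proof.
by move=> b3; rewrite /galkin_op galkin_muE3 // galkin_tauE opprD.
Qed.

Lemma char3_galkin_medial (A : zmodType) (c : A) :
  (forall a : A, a *+ 3 = 0) -> medial (galkin c).
Proof.
move=> A3 [x a] [y b] [z d] [w e].
rewrite -[@qop _]/(galkin_op c) !galkin_op_char3 //.
have fB := mulrn_Z3_additive (A3 c).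
congr (_, _); first by ring.
(* Collecting both sides as a sum of the four entries and one multiple of c
   reduces the claim to the symmetry of a polynomial over 'Z_3. *)
have collect (a1 b1 a2 b2 : A) (u v t : 'Z_3) :
    - (- (a1 + b1) + c *+ u + (- (a2 + b2) + c *+ v)) + c *+ t
    = (a1 + b1) + (a2 + b2) + c *+ (t - u - v)%R.
  by rewrite !fB !opprD !opprK [LHS](AC (((2*1)*(2*1))*1) ((1*2)*(4*5)*(7*3*6))).
rewrite !collect; congr (_ + c *+ _); first exact: addrACA.
congr nat_of_ord; apply/eqP; rewrite -subr_eq0; apply/eqP.
(* Over the integers the two polynomials differ by three times the factor
   given here. *)
rewrite -[RHS](Z3_mulrn3 ((y - z) * (1 - y - z + 2 * w))); ring.
Qed.

(** At [(0, 0), (0, b), (1, 0), (0, 0)] the two sides of the medial law have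
    [A]-parts [- 2b] and [b]: the two copies of [c] on the right cancel. *)
Lemma medial_galkin_char3 (A : zmodType) (c : A) :
  medial (galkin c) -> forall b : A, b *+ 3 = 0.
Proof.
move=> med b.
have := congr1 snd (med (0, 0) (0, b) (1, 0) (0, 0)).
rewrite /= /galkin_mu /galkin_tau /=.
rewrite !mulrN1z mul0rz !oppr0 !addr0 !add0r opprK oppr0 addr0 addrAC addNr.
by rewrite add0r => E; rewrite mulrSr -{2}E pmulrn subrr.
Qed.

Theorem proposition5p8 (A : zmodType) (c : A) :
  medial (galkin c) <-> (forall a : A, a *+ 3 = 0).
Proof.
by split; [exact: medial_galkin_char3 | exact: char3_galkin_medial].
Qed.
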